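(* Let $\mathcal H,\psi,\mathcal H^\psi,\tau^\psi,V_1,V_2,T,g,\alpha,\mathcal J$ be as in the context (in particular $\|T\|<1$ and $\mathcal J$ is coercive), and let $L,M\ge 1$ be integers. Let $u^{(0)}\in\mathcal H^\psi$ and let $(u^{(n)})_{n\in\mathbb N}$ be produced by the parallel alternating subspace minimization algorithm of the context. Then $(u^{(n)})_{n\in\mathbb N}$ is a sequence in $\mathcal H^\psi$ with the following properties: (i) $\mathcal J(u^{(n)})>\mathcal J(u^{(n+1)})$ for all $n\in\mathbb N$ (unless $u^{(n)}=u^{(n+1)}$); (ii) $\lim_{n\to\infty}\|u^{(n+1)}-u^{(n)}\|_{\mathcal H}=0$; (iii) the sequence $(u^{(n)})_{n\in\mathbb N}$ has subsequences which converge weakly in $\mathcal H$ and in $\mathcal H^\psi$ endowed with the topology $\tau^\psi$; (iv) if additionally $\dim\mathcal H<\infty$, $(u^{(n_k)})_{k\in\mathbb N}$ is a strongly converging subsequence, and $u^{(\infty)}$ is its limit, with $u_i^{(\infty)}:=\pi_{V_i}u^{(\infty)}$, then $u^{(\infty)}$ is a minimizer of $\mathcal J$ whenever one of the following conditions holds: (a) $\psi(u_1^{(\infty)}+\eta_2)+\psi(u_2^{(\infty)}+\eta_1)-\psi(u_1^{(\infty)}+u_2^{(\infty)})\le\psi(\eta_1+\eta_2)$ for all $\eta_i\in V_i$, $i=1,2$; (b) $\psi$ is differentiable at $u^{(\infty)}$ with respect to $V_i$ for one $i\in\{1,2\}$, i.e., there exists $\frac{\partial}{\partial V_i}\psi(u^{(\infty)}):=\zeta_i\in(V_i)'$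 such that $$\langle\zeta_i,v_i\rangle=\lim_{t\to0}\frac{\psi(u_1^{(\infty)}+u_2^{(\infty)}+tv_i)-\psi(u_1^{(\infty)}+u_2^{(\infty)})}{t}\quad\text{for all }v_i\in V_i.$$
   Context: $\mathcal H$ is a real separable Hilbert space. The function $\psi:\mathcal H\to\mathbb R_+\cup\{+\infty\}$ satisfies: $\psi(0)=0$; $\psi(u+v)\le\psi(u)+\psi(v)$ for all $u,v\in\mathcal H$; $\psi(\lambda u)=|\lambda|\psi(u)$ for all $\lambda\in\mathbb R$; and $\psi$ is lower semicontinuous with respect to norm convergence in $\mathcal H$. The set $\mathcal H^\psi=\{u\in\mathcal H:\psi(u)<\infty\}$ is a dense subspace of $\mathcal H$, $\psi|_{\mathcal H^\psi}$ is a seminorm, and $\mathcal H^\psi$ is a Banach space with the norm $\|u\|_{\mathcal H^\psi}=\|u\|_{\mathcal H}+\psi(u)$. There is a further topology $\tau^\psi$ on $\mathcal H^\psi$ such that every bounded sequence in $\mathcal H^\psi$ has a subsequence converging in $\tau^\psi$ to an element of $\mathcal H^\psi$, and $\psi$ is lower semicontinuous with respect to $\tau^\psi$. $V_1,V_2$ are closed, mutually orthogonal subspaces with $\mathcal H=V_1\oplus V_2$; $\pi_{V_i}$ is the orthogonal projection onto $V_i$; $(V_i)'$ is the dual of $V_i$; $V_i^\psi:=\mathcal H^\psi\cap V_i$. It is assumed that $\pi_{V_i}|_{\mathcal H^\psi}:\mathcal H^\psi\to V_i^\psi$ is well defined and continuous in the norm of $\mathcal H^\psi$, with range $V_i^\psi$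 closed, $i=1,2$. $T:\mathcal H\to\mathcal H$ is a bounded linear operator with $\|T\|<1$, $g\in\mathcal H$, $\alpha>0$, and $$\mathcal J(u)=\|Tu-g\|_{\mathcal H}^2+2\alpha\psi(u).$$ $\mathcal J$ is assumed coercive in $\mathcal H$: for every $C$ the set $\{u\in\mathcal H:\mathcal J(u)\le C\}$ is bounded in $\mathcal H$. For $u_1\in V_1$, $u_2\in V_2$, $i\in\{1,2\}$ and $a\in V_i$ define the surrogate functional $$\mathcal J_i^s(u_1+u_2,a)=\mathcal J(u_1+u_2)+\|u_i-a\|_{\mathcal H}^2-\|T(u_i-a)\|_{\mathcal H}^2 .$$ Parallel algorithm: pick an initial $u^{(0)}=u_1^{(0,L)}+u_2^{(0,M)}\in\mathcal H^\psi$ with $u_1^{(0,L)}\in V_1$, $u_2^{(0,M)}\in V_2$ (for example $u^{(0)}=0$), and for $n\ge0$ iterate: - $u_1^{(n+1,0)}=u_1^{(n,L)}$ and $u_1^{(n+1,\ell+1)}=\operatorname{argmin}_{u_1\in V_1}\mathcal J_1^s(u_1+u_2^{(n,M)},u_1^{(n+1,\ell)})$ for $\ell=0,\dots,L-1$; - $u_2^{(n+1,0)}=u_2^{(n,M)}$ and $u_2^{(n+1,m+1)}=\operatorname{argmin}_{u_2\in V_2}\mathcal J_2^s(u_1^{(n,L)}+u_2,u_2^{(n+1,m)})$ for $m=0,\dots,M-1$; - $u^{(n+1)}:=\dfrac{u_1^{(n+1,L)}+u_2^{(n+1,M)}+u^{(n)}}{2}$.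
   Formalization: In each outer step, u_1^{(n,L)} and u_2^{(n,M)} on the right-hand sides are read as the projections of the averaged iterate u^{(n)} onto V_1 and V_2, not the last inner iterates; with the latter, (i) fails (e.g. in R^2 with psi = 0, L = M = 10). *)

(* Defs.v *)
From mathcomp Require Import all_boot all_order all_algebra sesquilinear.
From mathcomp Require Import all_classical all_reals all_analysis.

Set Implicit Arguments.
Unset Strict Implicit.
Unset Printing Implicit Defensive.
Import Order.TTheory GRing.Theory Num.Theory numFieldNormedType.Exports.
Local Open Scope classical_set_scope.
Local Open Scope ring_scope.
Local Open Scope ereal_scope.

Definition subsequence (f : nat -> nat) : Prop :=
  {homo f : i j / (i < j)%N}.

Section Hilbert.
Context {R : realType} {H : completeNormedModType R}.

(* [H], a complete normed space, is a Hilbert space once its norm is the one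
   induced by the inner product [ip]. *)
Definition hilbert (ip : {dot H for idfun}) : Prop :=
  forall u, (`|u| ^+ 2 = ip u u)%R.

Definition separable : Prop := exists2 D : set H, countable D & dense D.

Definition finite_dimensional : Prop :=
  exists (d : nat) (e : 'I_d -> H),
    forall u, exists c : 'I_d -> R, u = (\sum_(i < d) c i *: e i)%R.

Definition subspace_of (V : set H) : Prop :=
  V 0%R /\ forall (a : R) u v, V u -> V v -> V (a *: u + v)%R.

Definition orthproj (ip : {dot H for idfun}) (V : set H) (u : H) : H :=
  xget 0%R [set v | V v /\ forall w, V w -> ip (u - v)%R w = 0%R].

Definition orthogonal_splitting (ip : {dot H for idfun}) (V1 V2 : set H) :
    Prop :=
  [/\ subspace_of V1 /\ closed V1,
      subspace_of V2 /\ closed V2,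
      forall v1 v2, V1 v1 -> V2 v2 -> ip v1 v2 = 0%R &
      forall u, exists v1 v2, [/\ V1 v1, V2 v2 & u = (v1 + v2)%R]].

Definition weakly_cvg (w : nat -> H) (l : H) : Prop :=
  forall f : {linear H -> R^o}, continuous f -> f (w k) @[k --> \oo] --> f l.

Definition bounded_operator (T : {linear H -> H}) : Prop :=
  exists M : R, forall u, (`|T u| <= M * `|u|)%R.

Definition operator_norm (T : {linear H -> H}) : R :=
  sup [set `|T u|%R | u in [set u : H | (`|u| <= 1)%R]].

Section Domain.
Variable psi : H -> \bar R.

Definition domain : set H := [set u | psi u < +oo].

Definition domain_norm (u : H) : \bar R := `|u|%:E + psi u.

Definition domain_complete : Prop :=
  forall w : nat -> H, (forall n, domain (w n)) ->
    (forall e : R, (0 < e)%R -> exists N : nat, forall m n : nat,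
       (N <= m)%N -> (N <= n)%N -> domain_norm (w m - w n)%R < e%:E) ->
  exists2 u, domain u & domain_norm (w n - u)%R @[n --> \oo] --> 0.

Definition domain_continuous (p : H -> H) : Prop :=
  forall u, domain u -> forall e : R, (0 < e)%R ->
  exists2 d : R, (0 < d)%R & forall v, domain v ->
    domain_norm (v - u)%R < d%:E -> domain_norm (p v - p u)%R < e%:E.

Definition domain_closed (A : set H) : Prop :=
  forall u, domain u ->
    (forall e : R, (0 < e)%R ->
       exists2 v, A v & domain_norm (v - u)%R < e%:E) ->
  A u.

Record penalty : Prop := Penalty {
  penalty_ge0 : forall u, 0 <= psi u;
  penalty0 : psi 0%R = 0;
  penaltyD : forall u v, psi (u + v)%R <= psi u + psi v;
  penaltyZ : forall (a : R) u, psi (a *: u)%R = `|a|%:E * psi u;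
  penalty_lsc : lower_semicontinuous psi;
  penalty_domain_subspace : subspace_of domain;
  penalty_domain_dense : dense domain;
  penalty_domain_complete : domain_complete }.

(* A topology on the subset [domain] of [H] is given as a topological space
   [X] together with an injection [j] of [X] into [H] with range [domain]. *)
Record penalty_topology (X : topologicalType) (j : X -> H) : Prop :=
  PenaltyTopology {
  penalty_topology_inj : injective j;
  penalty_topology_range : range j = domain;
  penalty_topology_compact : forall w : nat -> X,
    (exists C : R, forall n, domain_norm (j (w n)) <= C%:E) ->
    exists f : nat -> nat, subsequence f /\
    exists x : X, w (f k) @[k --> \oo] --> x;
  penalty_topology_lsc : lower_semicontinuous (psi \o j) }.

Definition penalty_topology_cvg (X : topologicalType) (j : X -> H)
    (w : nat -> H) (l : X) : Prop :=
  exists2 x : nat -> X, forall k, j (x k) = w k & x k @[k --> \oo] --> l.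

Definition compatible_projection (ip : {dot H for idfun}) (V : set H) :
    Prop :=
  [/\ forall u, domain u -> (domain `&` V) (orthproj ip V u),
      domain_continuous (orthproj ip V),
      orthproj ip V @` domain = domain `&` V &
      domain_closed (domain `&` V)].

(* [zeta] is only meaningful on [V], where it is a bounded linear
   functional. *)
Definition in_dual (V : set H) (zeta : H -> R) : Prop :=
  (forall (a : R) u v, V u -> V v ->
     (zeta (a *: u + v) = a * zeta u + zeta v)%R) /\
  exists C : R, forall v, V v -> (`|zeta v| <= C * `|v|)%R.

Definition differentiable_wrt (V : set H) (u : H) : Prop :=
  exists2 zeta : H -> R, in_dual V zeta &
  forall v, V v ->
    (psi (u + t *: v)%R - psi u) * (t^-1)%:E @[t --> (0%R : R)^']
      --> (zeta v)%:E.

End Domain.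

Section Functional.
Variables (psi : H -> \bar R) (T : {linear H -> H}) (g : H) (alpha : R).

Definition functional (u : H) : \bar R :=
  (`|T u - g| ^+ 2)%:E + (2 * alpha)%:E * psi u.

Definition coercive : Prop :=
  forall C : R, bounded_set [set u | functional u <= C%:E].

(* The surrogate J_i^s(u, a), where [ui] is the component of [u] in V_i. *)
Definition surrogate (u ui a : H) : \bar R :=
  functional u + (`|ui - a| ^+ 2 - `|T (ui - a)| ^+ 2)%:E.

Definition minimizer_on (V : set H) (F : H -> \bar R) (x : H) : Prop :=
  V x /\ forall y, V y -> F x <= F y.

(* [u n] is the n-th outer iterate, [u1 n l] and [u2 n m] are the inner ones.
   Each outer step works on the decomposition of the current iterate [u n] in
   V1 (+) V2: after the averaging step the components are those of the averaged
   vector, so that the inner iterations never start from the non-averaged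
   vectors [u1 n L], [u2 n M]. *)
Record parallel_algorithm (ip : {dot H for idfun}) (V1 V2 : set H)
    (L M : nat) (u : nat -> H) (u1 u2 : nat -> nat -> H) : Prop :=
  ParallelAlgorithm {
  parallel_init1 : forall n, u1 n.+1 0%N = orthproj ip V1 (u n);
  parallel_step1 : forall n l, (l < L)%N ->
    minimizer_on V1
      (fun v => surrogate (v + orthproj ip V2 (u n))%R v (u1 n.+1 l))
      (u1 n.+1 l.+1);
  parallel_init2 : forall n, u2 n.+1 0%N = orthproj ip V2 (u n);
  parallel_step2 : forall n m, (m < M)%N ->
    minimizer_on V2
      (fun v => surrogate (orthproj ip V1 (u n) + v)%R v (u2 n.+1 m))
      (u2 n.+1 m.+1);
  parallel_average : forall n,
    u n.+1 = (2^-1 *: (u1 n.+1 L + u2 n.+1 M + u n))%R }.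

End Functional.

End Hilbert.
Arguments separable {R} H.
Arguments finite_dimensional {R} H.

(* Main.v *)
Require Import Defs.
From mathcomp Require Import all_boot all_order all_algebra sesquilinear.
From mathcomp Require Import all_classical all_reals all_analysis.
From mathcomp Require Import ring lra.

Set Implicit Arguments.
Unset Strict Implicit.
Unset Printing Implicit Defensive.
Import Order.TTheory GRing.Theory Num.Theory numFieldNormedType.Exports.
Local Open Scope classical_set_scope.
Local Open Scope ring_scope.
Local Open Scope ereal_scope.

(* Each inner step decreases [J] by at least (1 - |T|^2) times its squared
   length, because the surrogate exceeds [J] by |v|^2 - |T v|^2.  As [J] is convex
   and [u n.+1] is the midpoint of the two half-updated points, the decrements
   of [J (u n)] control all inner and outer increments, which gives (i) and (ii).
   Weak limits come from an ultrafilter and the Riesz representation.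
   In finite dimension the dense subspace [domain psi] is everything and [psi] is
   continuous, so the inner minimality conditions pass to the limit: for [h] in
   V1 or in V2, alpha psi(u) <= <T u - g, T h> + alpha psi(u + h).  Condition (a)
   or (b) then merges the two partial conditions into one valid for all [h]. *)

(** * Identities and inequalities for the inner product and its norm *)

Section InnerProduct.
Context {R : realType} {H : completeNormedModType R}.
Variables (ip : {dot H for idfun}) (hH : hilbert ip).
Implicit Types u v w x y : H.

Lemma ipC u v : ip u v = ip v u.
Proof. by rewrite hermC expr0 mul1r. Qed.

Lemma ipDl u v w : (ip (u + v) w = ip u w + ip v w)%R.
Proof. exact: linearDl. Qed.

Lemma ipDr u v w : (ip w (u + v) = ip w u + ip w v)%R.
Proof. exact: linearDr. Qed.

Lemma ipZl (a : R) u w : (ip (a *: u) w = a * ip u w)%R.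
Proof. exact: linearZl_LR. Qed.

Lemma ipZr (a : R) u w : (ip w (a *: u) = a * ip w u)%R.
Proof. exact: linearZr_LR. Qed.

Lemma ipNl u w : (ip (- u) w = - ip u w)%R.
Proof. exact: linearNl. Qed.

Lemma ipNr u w : (ip w (- u) = - ip w u)%R.
Proof. exact: linearNr. Qed.

Lemma ip0l w : ip 0%R w = 0%R.
Proof. exact: linear0l. Qed.

Lemma ip_suml (I : Type) (r : seq I) (F : I -> H) w :
  (ip (\sum_(i <- r) F i) w = \sum_(i <- r) ip (F i) w)%R.
Proof. exact: linear_sumlz. Qed.

Definition ipE := (ipDl, ipDr, ipNl, ipNr, ipZl, ipZr).

Lemma sqr_normD u v : (`|u + v| ^+ 2 = `|u| ^+ 2 + 2 * ip u v + `|v| ^+ 2)%R.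
Proof. by rewrite !hH !ipE (ipC v u); ring. Qed.

Lemma sqr_normB u v : (`|u - v| ^+ 2 = `|u| ^+ 2 - 2 * ip u v + `|v| ^+ 2)%R.
Proof. by rewrite sqr_normD normrN ipNr mulrN. Qed.

Lemma cauchy_schwarz u v : (`|ip u v| <= `|u| * `|v|)%R.
Proof.
have [->|v0] := eqVneq v 0%R; first by rewrite ipC ip0l !normr0 mulr0.
have vp : (0 < `|v|)%R by rewrite normr_gt0.
rewrite -ler_sqr ?nnegrE ?mulr_ge0// real_normK ?num_real// exprMn.
(* Expanding this square gives [|v|^2] times the gap between the two squared sides. *)
have := sqr_ge0 (`| (`|v| ^+ 2) *: u - ip u v *: v|)%R.
rewrite sqr_normB !normrZ !exprMn !ipE !real_normK ?num_real//.
rewrite [X in (0 <= X)%R](_ : _ = `|v| ^+ 2 * (`|u| ^+ 2 * `|v| ^+ 2 - ip u v ^+ 2))%R.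
  by rewrite pmulr_rge0 ?exprn_gt0// subr_ge0.
by ring.
Qed.

Lemma parallelogram u v :
  (`|u - v| ^+ 2 + 4 * `|2^-1 *: (u + v)| ^+ 2 = 2 * `|u| ^+ 2 + 2 * `|v| ^+ 2)%R.
Proof.
by rewrite sqr_normB normrZ exprMn sqr_normD gtr0_norm// exprVn; field.
Qed.

Lemma ip_continuousl v : continuous (ip^~ v).
Proof.
move=> u; apply/(@cvgrPdist_lt _ R^o) => e e0.
have C0 : (0 < `|v| + 1)%R by rewrite ltr_wpDl.
near=> x; rewrite -ipNl -ipDl (le_lt_trans (cauchy_schwarz _ _))//.
rewrite (@le_lt_trans _ _ (`|u - x| * (`|v| + 1))%R) ?ler_wpM2l ?lerDl//.
rewrite -ltr_pdivlMr//; near: x.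
by apply: cvgr_dist_lt; [exact: cvg_id|rewrite divr_gt0].
Unshelve. all: by end_near. Qed.

End InnerProduct.

(** * Riesz representation and weak sequential compactness of bounded sequences *)

Section WeakCompactness.
Context {R : realType} {H : completeNormedModType R}.
Variables (ip : {dot H for idfun}) (hH : hilbert ip).
Implicit Types u v w x y : H.

Lemma cauchy_seq_cvg (x : nat -> H) :
  (forall e : R, (0 < e)%R -> exists N, forall m n,
     (N <= m)%N -> (N <= n)%N -> (`|x m - x n| < e)%R) -> cvg (x @ \oo).
Proof.
move=> cx; apply/cauchy_cvgP/cauchy_exP => e e0.
have [N xN] := cx e e0; exists (x N), N => // n /= Nn.
by rewrite -ball_normE /=; exact: xN.
Qed.

(* The representative is the minimiser of [|x|^2 - 2 phi x]: minimising
   sequences are Cauchy by the parallelogram identity. *)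
Lemma riesz (phi : H -> R) (C : R) :
  (forall (a : R) u v, phi (a *: u + v) = a * phi u + phi v)%R ->
  (forall u, `|phi u| <= C * `|u|)%R ->
  exists y, forall x, phi x = ip y x.
Proof.
move=> phiL phiC.
have phi0 : phi 0%R = 0%R by have := phiL (- 1)%R 0%R 0%R; rewrite scaler0 addr0; lra.
have phiD u v : (phi (u + v) = phi u + phi v)%R.
  by rewrite -[u in LHS]scale1r phiL mul1r.
have phiZ a u : (phi (a *: u) = a * phi u)%R.
  by rewrite -[in LHS](addr0 (a *: u)) phiL phi0 addr0.
pose F x : R := (`|x| ^+ 2 - 2 * phi x)%R.
have FL x : (- C ^+ 2 <= F x)%R.
  have := phiC x; rewrite /F ler_norml => /andP[_ h].
  have := sqr_ge0 (`|x| - C)%R; nra.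
have hinf : has_inf (range F).
  by split; [exists (F 0%R), 0%R | exists (- C ^+ 2)%R => _ [x _ <-]].
pose m := inf (range F).
have mF x : (m <= F x)%R by apply: ge_inf; [case: hinf|exists x].
have /choice[x xm] n : exists x, (F x < m + harmonic n)%R.
  have [_ [x _ <-] h] := inf_adherent (harmonic_gt0 n) hinf.
  by exists x.
have dx i k : (`|x i - x k| ^+ 2 < 2 * (harmonic i + harmonic k))%R.
  have := parallelogram hH (x i) (x k).
  have := mF (2^-1 *: (x i + x k))%R; have := xm i; have := xm k.
  by rewrite /F phiZ phiD; lra.
have hlim : (harmonic n : R) @[n --> \oo] --> (0%R : R) by exact: cvg_harmonic.
have cx : cvg (x @ \oo).
  apply: cauchy_seq_cvg => e e0.
  have e4 : (0 < e ^+ 2 / 4)%R by rewrite divr_gt0 ?exprn_gt0.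
  have /cvgrPdist_lt/(_ _ e4)[N _ hN] := hlim.
  have hN' i : (N <= i)%N -> (harmonic i < e ^+ 2 / 4 :> R)%R.
    by move=> /hN/=; rewrite sub0r normrN ger0_norm// invr_ge0.
  exists N => i k /hN' hi /hN' hk.
  rewrite -ltr_sqr ?nnegrE// ?(ltW e0)//.
  by apply: (lt_le_trans (dx i k)); lra.
pose y := lim (x @ \oo); exists y => z.
(* From [m <= F (x n + t z)] and [F (x n) < m + harmonic n], the limit [n -> oo] leaves a
   nonnegative quadratic in [t] without constant term, so its linear coefficient must vanish. *)
have key (t : R) : (0 <= t ^+ 2 * `|z| ^+ 2 + 2 * t * (ip y z - phi z))%R.
  have c1 : (ip (x n) z @[n --> \oo] --> ip y z)%R.
    by apply: (cvg_comp x (ip^~ z)); [exact: cx|exact: ip_continuousl].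
  have c2 : (t ^+ 2 * `|z| ^+ 2 + 2 * t * (ip (x n) z - phi z) + harmonic n
      @[n --> \oo] --> t ^+ 2 * `|z| ^+ 2 + 2 * t * (ip y z - phi z) + 0)%R.
    apply: cvgD => //; apply: cvgD; first exact: cvg_cst.
    apply: cvgM; first exact: cvg_cst.
    by apply: cvgB => //; exact: cvg_cst.
  rewrite addr0 in c2; rewrite -(cvg_lim _ c2)//.
  apply: limr_ge; first by apply/cvg_ex; eexists; exact: c2.
  near=> n; have := mF (x n + t *: z)%R; have := xm n.
  rewrite /F (sqr_normD hH) phiD phiZ ipZr normrZ exprMn real_normK ?num_real//.
  by lra.
have d0 : (0 < `|z| ^+ 2 + 1)%R by rewrite ltr_wpDl ?sqr_ge0.
(* This [t] nearly minimises the quadratic, the [+ 1] covering [z = 0]; the value there is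
   [- d^2 (q + 2) / (q + 1)^2], which forces [d = 0]. *)
have := key (- (ip y z - phi z) / (`|z| ^+ 2 + 1))%R.
set d := (ip y z - phi z)%R; set q := (`|z| ^+ 2)%R in d0 *.
have q0 : (0 <= q)%R by rewrite sqr_ge0.
rewrite [X in (0 <= X)%R](_ : _ = - (d ^+ 2 * ((q + 2) / (q + 1) ^+ 2)))%R; last first.
  by field; lra.
rewrite oppr_ge0 pmulr_lle0 ?divr_gt0 ?exprn_gt0//; last by lra.
move=> d2; apply/esym/eqP; rewrite -subr_eq0 -/d -sqrf_eq0.
by rewrite eq_le d2 sqr_ge0.
Unshelve. all: by end_near. Qed.

(** Compactness of [[-C, C]] gives a cluster point. An ultrafilter converges to its cluster points:
    if a neighbourhood were not in it, its complement would be, and that misses the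
    neighbourhood. *)
Lemma ultra_bounded_cvg (I : Type) (G : set_system I) (f : I -> R) (C : R) :
  UltraFilter G -> (forall n, `|f n| <= C)%R -> exists l : R, f @ G --> l.
Proof.
move=> UG fC.
have [|l [_ lG]] := @segment_compact _ (- C)%R C (f @ G) _.
  by apply: (@filterE _ G) => n /=; rewrite in_itv /= -ler_norml.
exists l => N lN.
have [//|GN] := in_ultra_setVsetC (f @^-1` N) UG.
by have [r [/= NrC Nr]] := lG (~` N) N GN lN.
Qed.

Lemma separable_dense_seq : separable H ->
  exists d : nat -> H, forall x (e : R), (0 < e)%R -> exists i, (`|x - d i| < e)%R.
Proof.
move=> [D cD dD].
have /pfcard_geP[D0|[d]] := cD.
  have [|x []] := dD setT _ openT; first by exists 0%R.
  by rewrite D0.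
exists d => x e e0.
have [||y [xy Dy]] := dD (ball x e).
- by exists x; exact: ballxx.
- exact: ball_open.
have [i _ di] := @surj _ _ _ _ d y Dy.
by exists i; rewrite di; move: xy; rewrite -ball_normE.
Qed.

(** Along an ultrafilter finer than [\oo] all [ip (w n) x] converge, and their limit is a bounded
    linear form of [x], hence given by some [l]. Separability then replaces the ultrafilter by a
    genuine subsequence, tested on a countable dense family; boundedness extends the convergence to
    every test vector. *)
Lemma bounded_weakly_cvg_subseq (w : nat -> H) (C : R) : separable H ->
  (forall n, `|w n| <= C)%R ->
  exists f : nat -> nat, subsequence f /\ exists l, weakly_cvg (w \o f) l.
Proof.
move=> /separable_dense_seq[d dd] wC.
have C0 : (0 <= C)%R by exact: le_trans (normr_ge0 _) (wC 0%N).
have [G [UG oG]] := @ultraFilterLemma nat \oo _.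
have wxC x n : (`|ip (w n) x| <= C * `|x|)%R.
  by rewrite (le_trans (cauchy_schwarz hH _ _))// ler_wpM2r.
have /choice[phi phiG] x : exists l : R, ip (w n) x @[n --> G] --> l.
  exact: ultra_bounded_cvg UG (wxC x).
have [||l phil] := @riesz phi C.
- move=> a u v.
  apply: (cvg_unique _ (phiG (a *: u + v)%R)) => //.
  rewrite (_ : (fun n => _) = (fun n => a * ip (w n) u + ip (w n) v)%R).
    2: by apply/funext => n; rewrite ipDr ipZr.
  apply: cvgD => //; apply: cvgM => //; exact: cvg_cst.
- move=> u; rewrite -(cvg_lim _ (cvg_norm (phiG u)))//.
  apply: limr_le; last by near=> n; exact: wxC.
  by apply/cvg_ex; eexists; exact: cvg_norm (phiG u).
(* Closeness to [l] against the first [k + 1] dense vectors is a finite set of conditions, so it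
   holds on a member of the ultrafilter, which meets every tail. *)
pose close k n := forall i, (i <= k)%N -> (`|ip (w n - l) (d i)| < harmonic k)%R.
have exn k N : exists n, (N < n)%N /\ close k n.
  have G1 : G [set n | (N < n)%N] by apply: oG; exists N.+1.
  have G2 : G [set n | forall i : 'I_k.+1, (`|ip (w n - l) (d i)| < harmonic k)%R].
    apply: filter_forall => i.
    have /cvgrPdist_lt/(_ _ (harmonic_gt0 k)) := phiG (d i).
    by apply: filterS => n; rewrite phil -ipNl -ipDl -normrN -ipNl opprB.
  have [n [/= Nn Hn]] := @filter_ex _ G _ _ (@filterI _ G _ _ _ G1 G2).
  by exists n; split=> // i ik; have := Hn (Ordinal (ik : (i < k.+1)%N)).
have /choice[s /all_and2[s1 s2]] (kN : nat * nat) :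
    exists n, (kN.2 < n)%N /\ close kN.1 n.
  exact: exn.
pose f := fix f k := if k is k'.+1 then s (k, f k') else s (0%N, 0%N).
have fclose k : close k (f k).
  by case: k => [|k]; [exact: (s2 (0%N, 0%N))|exact: (s2 (k.+1, f k))].
exists f; split.
  apply: homo_ltn; first exact: ltn_trans.
  by move=> k; exact: (s1 (k.+1, f k)).
exists l => F cF.
have [B BF] : exists B : R, forall x, (`|F x| <= B * `|x|)%R.
  have /linear_boundedP := continuous_linear_bounded 0%R (cF 0%R).
  case=> B [_ hB]; exists (B + 1)%R; apply: hB; lra.
have [y yF] : exists y, forall x, F x = ip y x.
  apply: (@riesz F B) => // a u v; exact: linearP.
apply/(@cvgrPdist_lt _ R^o) => e e0.
pose K := (C + `|l| + 1)%R.
have K0 : (0 < K)%R by rewrite ltr_wpDl// addr_ge0.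
have e2 : (0 < e / 2)%R by rewrite divr_gt0.
have [i yi] := dd y (e / 2 / K)%R (divr_gt0 e2 K0).
have /cvgrPdist_lt/(_ _ e2)[N _ hN] : (harmonic n : R) @[n --> \oo] --> (0%R : R).
  exact: cvg_harmonic.
(* [i <= k] puts [d i] among the vectors controlled by [close k], and [N <= k] makes that control
   finer than [e / 2]. *)
exists (maxn N i) => // k /=; rewrite geq_max => /andP[Nk ik].
rewrite -normrN opprB !yF -ipNr -ipDr ipC.
rewrite -[y](subrK (d i)) ipDr (le_lt_trans (ler_normD _ _))//.
rewrite [ltRHS](splitr e) ltr_leD//; last first.
  apply/ltW/(lt_trans (fclose k i ik)).
  by have := hN k Nk; rewrite /= sub0r normrN ger0_norm ?harmonic_ge0.
rewrite (le_lt_trans (cauchy_schwarz hH _ _))//.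
apply: (@le_lt_trans _ _ (K * `|y - d i|)%R).
  rewrite ler_wpM2r// (le_trans (ler_normB _ _))//.
  by rewrite /K; have := wC (f k); lra.
by rewrite mulrC -ltr_pdivlMr.
Unshelve. all: by end_near. Qed.

End WeakCompactness.

(** * Closure properties of linear subspaces *)

Section Subspace.
Context {R : realType} {H : completeNormedModType R}.
Variables (V : set H) (hV : subspace_of V).

Lemma subspaceZ (a : R) u : V u -> V (a *: u)%R.
Proof.
move=> Vu; rewrite -[(a *: u)%R]addr0.
by apply: (proj2 hV) => //; exact: (proj1 hV).
Qed.

Lemma subspaceD u v : V u -> V v -> V (u + v)%R.
Proof. by move=> Vu Vv; rewrite -[u]scale1r; exact: (proj2 hV). Qed.

Lemma subspaceB u v : V u -> V v -> V (u - v)%R.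
Proof. by move=> Vu Vv; apply: subspaceD => //; rewrite -scaleN1r; exact: subspaceZ. Qed.

Lemma subspace_sum (r : seq H) (c : H -> R) :
  (forall b, b \in r -> V b) -> V (\sum_(b <- r) c b *: b)%R.
Proof.
elim: r => [|b r IH] rV; first by rewrite big_nil; exact: (proj1 hV).
rewrite big_cons; apply: subspaceD.
  by apply/subspaceZ/rV; rewrite mem_head.
by apply: IH => x xr; apply: rV; rewrite inE xr orbT.
Qed.

End Subspace.

(** * Orthogonal projections onto the two summands *)

Section Splitting.
Context {R : realType} {H : completeNormedModType R}.
Variables (ip : {dot H for idfun}) (hH : hilbert ip).

Variables (V1 V2 : set H) (hV : orthogonal_splitting ip V1 V2).

(** [v1] has the defining property, so [xget] does not fall back on its default; any candidate [y]
    makes [v1 - y] an element of [V1] orthogonal to itself. *)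
Lemma orthproj_add v1 v2 : V1 v1 -> V2 v2 -> orthproj ip V1 (v1 + v2)%R = v1.
Proof.
case: hV => -[sV1 _] _ ort _ V1v V2v; rewrite /orthproj.
case: xgetP => [y _ [V1y yort]|/(_ v1)[]]; last first.
  by split=> // w V1w; rewrite addrAC subrr add0r ipC ort.
have Vd : V1 (v1 - y)%R by exact: (subspaceB sV1).
apply/esym/eqP; rewrite -subr_eq0 -normr_eq0 -sqrf_eq0 hH; apply/eqP.
by have := yort _ Vd; rewrite addrAC ipDl (ipC ip v2) (ort _ _ Vd V2v) addr0.
Qed.

Lemma orthproj_split u :
  [/\ V1 (orthproj ip V1 u), V2 (orthproj ip V2 u) &
      (orthproj ip V1 u + orthproj ip V2 u = u)%R].
Proof.
case: (hV) => _ _ ort /(_ u)[v1 [v2 [V1v V2v ->]]].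
rewrite orthproj_add//; suff -> : orthproj ip V2 (v1 + v2)%R = v2 by [].
case: (hV) => -[sV1 _] [sV2 _] _ _.
rewrite /orthproj; case: xgetP => [y _ [V2y yort]|/(_ v2)[]]; last first.
  by split=> // w V2w; rewrite addrK ort.
have Vd : V2 (v2 - y)%R by exact: (subspaceB sV2).
apply/esym/eqP; rewrite -subr_eq0 -normr_eq0 -sqrf_eq0 hH; apply/eqP.
by have := yort _ Vd; rewrite -addrA ipDl (ort _ _ V1v Vd) add0r.
Qed.

End Splitting.

(** * Finite orthonormal expansions *)

Section FiniteDimension.
Context {R : realType} {H : completeNormedModType R}.
Variables (ip : {dot H for idfun}) (hH : hilbert ip).

(** Gram-Schmidt by induction on the number of spanning vectors: the part [W'] of [W] spanned by the
    first [d] of them has an expansion, and at most one further unit vector [n] is missing. The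
    [e i] may lie outside [W]. *)
Lemma orthonormal_expansion (d : nat) (e : 'I_d -> H) (W : set H) :
  subspace_of W ->
  (forall u, W u -> exists c : 'I_d -> R, u = (\sum_(i < d) c i *: e i)%R) ->
  exists b : seq H, (forall x, x \in b -> W x) /\
    forall u, W u -> u = (\sum_(x <- b) ip u x *: x)%R.
Proof.
elim: d e W => [|d IH] e W sW We.
  exists [::]; split=> // u /We[c ->]; by rewrite big_ord0 big_nil.
pose e' i := e (widen_ord (leqnSn d) i).
pose W' := [set u | W u /\ exists c : 'I_d -> R, u = (\sum_(i < d) c i *: e' i)%R].
have sW' : subspace_of W'.
  split.
    split; first exact: (proj1 sW).
    by exists (fun=> 0%R); rewrite big1// => i _; rewrite scale0r.
  move=> a u v [Wu [c Eu]] [Wv [c' Ev]]; split; first exact: (proj2 sW).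
  exists (fun i => a * c i + c' i)%R.
  rewrite Eu Ev scaler_sumr -big_split/=; apply: eq_bigr => i _.
  by rewrite scalerDl scalerA.
have [|b [bW' bE]] := IH e' W' sW'; first by move=> u [].
have [WW'|] := pselect (forall u, W u -> W' u).
  by exists b; split=> [x /bW'[]//|u /WW'/bE].
move=> /existsNP[w /not_implyP[Ww W'w]].
pose w' := (w - \sum_(x <- b) ip w x *: x)%R.
have Sw : W' (\sum_(x <- b) ip w x *: x)%R by exact: (@subspace_sum _ _ W').
have Ww' : W w' by apply: subspaceB => //; case: Sw.
have W'w' : ~ W' w'.
  move=> h; apply: W'w; rewrite -(subrK (\sum_(x <- b) ip w x *: x)%R w).
  exact: subspaceD.
have w'0 : (`|w'| != 0)%R.
  by rewrite normr_eq0; apply/eqP => w0; apply: W'w'; rewrite w0; exact: (proj1 sW').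
have ortw x : W' x -> ip w' x = 0%R.
  move=> /bE Ex; rewrite [in LHS]Ex ipDl ipNl [X in (_ - X)%R]ip_suml.
  rewrite ipC ip_suml -sumrB big1// => y _.
  by rewrite !ipZl -Ex (ipC ip x y) (ipC ip y w) mulrC subrr.
pose n := (`|w'|^-1 *: w')%R.
have nn : ip n n = 1%R by rewrite /n ipZl ipZr -hH; field.
have nx x : W' x -> ip n x = 0%R by move=> /ortw h; rewrite ipZl h mulr0.
(* The last coefficient of [w'] is nonzero because [w'] is not in [W'], so a multiple of [w']
   cancels the last coefficient of [u]. *)
have Wdec u : W u -> exists (c : R) v, W' v /\ u = (v + c *: n)%R.
  move=> Wu; have [cu Eu] := We u Wu; have [cw Ew] := We w' Ww'.
  have cw0 : cw ord_max != 0%R.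
    apply/eqP => cw0; apply: W'w'; split=> //.
    exists (fun i => cw (widen_ord (leqnSn d) i)).
    by rewrite {1}Ew big_ord_recr/= cw0 scale0r addr0.
  pose r := (cu ord_max / cw ord_max)%R.
  exists (r * `|w'|)%R, (u - r *: w')%R; split; last first.
    by rewrite /n scalerA mulfK// subrK.
  split; first by apply: subspaceB => //; exact: subspaceZ.
  exists (fun i => cu (widen_ord (leqnSn d) i) - r * cw (widen_ord (leqnSn d) i))%R.
  rewrite [in LHS]Eu [in LHS]Ew !big_ord_recr/= scalerDr opprD addrACA.
  rewrite scalerA divfK// subrr addr0 scaler_sumr -sumrB.
  by apply: eq_bigr => i _; rewrite scalerBl scalerA.
exists (n :: b); split.
  move=> x; rewrite inE => /orP[/eqP->|/bW'[]//].
  exact: subspaceZ.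
move=> u /Wdec[c [v [W'v ->]]]; rewrite big_cons ipDl (ipC ip v) nx// add0r.
rewrite ipZl nn mulr1 [in LHS]addrC; congr +%R.
rewrite [in LHS](bE v)//; apply: eq_big_seq => x /bW' W'x.
by rewrite ipDl ipZl nx// mulr0 addr0.
Qed.

End FiniteDimension.

(** * Convexity of the functional and descent of the inner iterations *)

Section Functional.
Context {R : realType} {H : completeNormedModType R}.
Variables (ip : {dot H for idfun}) (hH : hilbert ip).
Variables (psi : H -> \bar R) (hpsi : penalty psi).
Variables (T : {linear H -> H}) (g : H) (alpha : R) (halpha : (0 < alpha)%R).
Implicit Types u v w x y : H.

Local Notation p u := (fine (psi u)).

Lemma domain_fine u : domain psi u -> psi u = (p u)%:E.
Proof.
rewrite /domain/= => pu; rewrite fineK// ge0_fin_numE//.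
exact: penalty_ge0.
Qed.

Lemma fine_penalty_ge0 u : (0 <= p u)%R.
Proof. exact/fine_ge0/penalty_ge0. Qed.

Lemma fine_penaltyD u v : domain psi u -> domain psi v ->
  (p (u + v) <= p u + p v)%R.
Proof.
move=> du dv; rewrite -lee_fin EFinD -!domain_fine//; first exact: penaltyD.
exact: (subspaceD (penalty_domain_subspace hpsi)).
Qed.

Lemma fine_penaltyZ (a : R) u : domain psi u -> (p (a *: u) = `|a| * p u)%R.
Proof. by move=> du; rewrite penaltyZ// (domain_fine du). Qed.

Definition functional_fine u : R := (`|T u - g| ^+ 2 + 2 * alpha * p u)%R.

Local Notation J := functional_fine.

Lemma functional_fineE u : domain psi u -> functional psi T g alpha u = (J u)%:E.
Proof. by move=> du; rewrite /functional (domain_fine du). Qed.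

Lemma functional_fine_ge0 u : (0 <= J u)%R.
Proof. by rewrite addr_ge0 ?sqr_ge0// !mulr_ge0 ?fine_penalty_ge0// ltW. Qed.

(** As [alpha > 0], the functional is [+oo] outside the domain, so domination by a finite value
    forces membership. This keeps surrogate minimisers in the domain and moves the estimates to the
    reals. *)
Lemma le_functional_fine x y (a b : R) : domain psi y ->
  functional psi T g alpha x + a%:E <= functional psi T g alpha y + b%:E ->
  domain psi x /\ (J x + a <= J y + b)%R.
Proof.
move=> dy; rewrite (functional_fineE dy).
have [dx|ndx] := pselect (domain psi x).
  by rewrite (functional_fineE dx) -!EFinD lee_fin.
suff -> : functional psi T g alpha x = +oo by [].
rewrite /functional; have -> : psi x = +oo.
  by apply/eqP; rewrite -leye_eq leNgt; apply/negP.
by rewrite gt0_muley ?lte_fin ?mulr_gt0.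
Qed.

(** The parallelogram identity treats the residuals [T u - g] and [T v - g]; subadditivity and
    homogeneity treat the penalty. *)
Lemma functional_fine_mid u v : domain psi u -> domain psi v ->
  domain psi (2^-1 *: (u + v))%R /\ (J (2^-1 *: (u + v)) <= (J u + J v) / 2)%R.
Proof.
move=> du dv; have sD := penalty_domain_subspace hpsi.
have duv := subspaceD sD du dv; split; first exact: subspaceZ.
rewrite /J fine_penaltyZ// gtr0_norm// linearZ linearD/=.
have := fine_penaltyD du dv.
have -> : (2^-1 *: (T u + T v) - g = 2^-1 *: ((T u - g) + (T v - g)))%R.
  rewrite addrACA [in RHS]scalerDr -mulr2n -[(- g *+ 2)%R]scaler_nat scalerA mulVf//.
  by rewrite scale1r.
have := parallelogram hH (T u - g)%R (T v - g)%R.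
have := sqr_ge0 (`|T u - g - (T v - g)|)%R.
by have := halpha; nra.
Qed.

Variables (kappa : R) (kappa0 : (0 < kappa)%R).
Hypothesis hkappa : forall u, (kappa * `|u| ^+ 2 <= `|u| ^+ 2 - `|T u| ^+ 2)%R.

Lemma surrogate_descent (V : set H) b c y : V c -> domain psi (c + b)%R ->
  minimizer_on V (fun v => surrogate psi T g alpha (v + b)%R v c) y ->
  [/\ V y, domain psi (y + b)%R &
      (J (y + b) + kappa * `|y - c| ^+ 2 <= J (c + b))%R].
Proof.
move=> Vc dc [Vy /(_ c Vc)]; rewrite /surrogate => /le_functional_fine[]// dy.
rewrite subrr linear0 normr0 subrr addr0 => le.
by split=> //; apply: le_trans le; rewrite lerD2l hkappa.
Qed.

(** The factor [4 ^+ l] absorbs the doubling in [|x + y|^2 <= 2 |x|^2 + 2 |y|^2] at each step; the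
    case [l = 0] says that the functional has not increased. *)
Lemma inner_descent (V : set H) b (w : nat -> H) (N : nat) :
  V (w 0%N) -> domain psi (w 0%N + b)%R ->
  (forall l, (l < N)%N ->
    minimizer_on V (fun v => surrogate psi T g alpha (v + b)%R v (w l)) (w l.+1)) ->
  [/\ V (w N), domain psi (w N + b)%R &
      forall l, (l <= N)%N ->
        (kappa * `|w l - w 0%N| ^+ 2 <= 4 ^+ l * (J (w 0%N + b) - J (w N + b)))%R].
Proof.
move=> Vw dw; elim: N => [|N IH] wmin.
  by split=> // -[|//] _; rewrite !subrr normr0 expr0n mulr0 mulr0.
have [|VN dN wN] := IH; first by move=> l lN; apply: wmin; exact: ltnW.
have [VN1 dN1 le] := surrogate_descent VN dN (wmin N (ltnSn N)).
have leN : (J (w N.+1 + b) <= J (w N + b))%R.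
  by apply: le_trans le; rewrite lerDl mulr_ge0// ?ltW// exprn_gt0.
split=> // l; rewrite leq_eqVlt => /orP[/eqP->|]; last first.
  rewrite ltnS => /wN /le_trans; apply; rewrite ler_wpM2l ?exprn_ge0//.
  by rewrite lerB.
have h := wN N (leqnn N).
have -> : (w N.+1 - w 0%N = (w N.+1 - w N) + (w N - w 0%N))%R by rewrite addrA subrK.
set x := (w N.+1 - w N)%R in le *; set y := (w N - w 0%N)%R in h *.
have p4 : (1 <= 4 ^+ N :> R)%R by rewrite exprn_ege1// ler1n.
have xy : (`|x + y| ^+ 2 <= 2 * `|x| ^+ 2 + 2 * `|y| ^+ 2)%R.
  rewrite -(parallelogram hH) normrZ gtr0_norm// exprMn.
  by have := sqr_ge0 `|x - y|%R; lra.
apply: le_trans (ler_wpM2l (ltW kappa0) xy) _; rewrite [(4 ^+ N.+1)%R]exprS.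
set q := (4 ^+ N)%R in h p4 *.
(* As [q >= 1], the last decrease is at most [q] times itself; the sum telescopes to [2 * q] times
   the total decrease, which is nonnegative and so at most [4 * q] times it. *)
have : (0 <= (q - 1) * (J (w N + b) - J (w N.+1 + b)))%R by rewrite mulr_ge0; lra.
have : (0 <= q * (J (w 0%N + b) - J (w N.+1 + b)))%R.
  have : (0 <= kappa * `|y| ^+ 2)%R by rewrite mulr_ge0 ?sqr_ge0// ltW.
  by nra.
lra.
Qed.

End Functional.

(** * The gap [|u|^2 - |T u|^2] of a strict contraction *)

Section Contraction.
Context {R : realType} {H : completeNormedModType R} (T : {linear H -> H}).

Lemma operator_norm_le : bounded_operator T ->
  forall u : H, (`|T u| <= operator_norm T * `|u|)%R.
Proof.
move=> [B TB] u; have [->|u0] := eqVneq u 0%R.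
  by rewrite linear0 !normr0 mulr0.
have u0' : (0 < `|u|)%R by rewrite normr_gt0.
rewrite -ler_pdivrMr//.
have -> : (`|T u| / `|u| = `|T (`|u|^-1 *: u)|)%R.
  by rewrite linearZ normrZ normfV normr_id mulrC.
apply: ub_le_sup.
  exists `|B|%R => _ [v /= v1 <-]; apply: le_trans (TB v) _.
  by have := normr_ge0 v; have := ler_norm B; have := normr_ge0 B; nra.
by exists (`|u|^-1 *: u)%R => //=; rewrite normrZ normfV normr_id mulVf// gt_eqF.
Qed.

Lemma contraction_gap : bounded_operator T -> (operator_norm T < 1)%R ->
  exists2 kappa : R, (0 < kappa)%R &
    forall u : H, (kappa * `|u| ^+ 2 <= `|u| ^+ 2 - `|T u| ^+ 2)%R.
Proof.
(* The maximum with 0 makes [q] visibly nonnegative, so that the bound can be squared. *)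
move=> bT T1; pose q := Num.max 0%R (operator_norm T).
have q0 : (0 <= q)%R by rewrite le_max lexx.
have q1 : (q < 1)%R by rewrite gt_max ltr01.
exists (1 - q ^+ 2)%R; first by rewrite subr_gt0 expr_lt1.
move=> u; have Tq : (`|T u| <= q * `|u|)%R.
  apply: le_trans (operator_norm_le bT u) _.
  by rewrite ler_wpM2r// le_max lexx orbT.
have : (`|T u| ^+ 2 <= (q * `|u|) ^+ 2)%R.
  by rewrite ler_sqr// nnegrE// mulr_ge0.
by rewrite exprMn; lra.
Qed.

End Contraction.

(** * Continuity of the penalty and first-order conditions in finite dimension *)

Section FiniteDimensionalOptimality.
Context {R : realType} {H : completeNormedModType R}.
Variables (ip : {dot H for idfun}) (hH : hilbert ip).
Variables (psi : H -> \bar R) (hpsi : penalty psi).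
Implicit Types u v w x y h : H.

Local Notation p u := (fine (psi u)).

(** The expansion map [S] of the domain is linear and bounded and fixes the domain, hence by density
    fixes every vector. Subadditivity along the expansion, with Cauchy-Schwarz on its coefficients,
    then bounds the penalty. *)
Lemma penalty_finite_dimensional : finite_dimensional H ->
  (forall u, domain psi u) /\ exists C : R, forall u, (p u <= C * `|u|)%R.
Proof.
move=> [d [e eE]]; have sD := penalty_domain_subspace hpsi.
have [b [bD bE]] := orthonormal_expansion hH sD (fun u _ => eE u).
pose S u := (\sum_(x <- b) ip u x *: x)%R.
have SD u : domain psi (S u) by exact: subspace_sum.
pose K := (\sum_(x <- b) `|x| ^+ 2)%R.
have K0 : (0 <= K)%R by apply: sumr_ge0 => x _; exact: sqr_ge0.
have SK u : (`|S u| <= K * `|u|)%R.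
  apply: le_trans (ler_norm_sum _ _ _) _; rewrite mulr_suml ler_sum// => x _.
  rewrite normrZ expr2 mulrAC ler_wpM2r// mulrC; exact: cauchy_schwarz.
have SB u v : S (u - v)%R = (S u - S v)%R.
  by rewrite /S -sumrB; apply: eq_bigr => x _; rewrite ipDl ipNl scalerBl.
have SE u : u = S u.
  apply/eqP; rewrite -subr_eq0 -normr_le0; apply/ler_addgt0Pl => eps eps0.
  rewrite addr0; have K1 : (0 < 1 + K)%R by rewrite ltr_pwDl.
  have [||v [uv Dv]] := penalty_domain_dense hpsi (O := ball u (eps / (1 + K))%R).
  - by exists u; apply: ballxx; rewrite divr_gt0.
  - exact: ball_open.
  have -> : (u - S u = (u - v) - S (u - v))%R.
    by rewrite SB (_ : S v = v); [rewrite opprB addrA subrK|rewrite /S -bE].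
  apply: le_trans (ler_normB _ _) _.
  apply: le_trans (lerD (lexx _) (SK _)) _.
  move: uv; rewrite -ball_normE /= ltr_pdivlMr// => /ltW.
  by apply: le_trans; rewrite mulrDr mulr1 mulrC.
have full u : domain psi u by rewrite (SE u).
split=> //; exists (\sum_(x <- b) `|x| * p x)%R => u.
rewrite [in leLHS](SE u) /S; elim: b {bD bE S SD K K0 SK SB SE} => [|x b IH].
  by rewrite !big_nil mul0r penalty0.
rewrite !big_cons mulrDl; apply: le_trans (fine_penaltyD hpsi (full _) (full _)) _.
apply: lerD => //; rewrite fine_penaltyZ// mulrAC ler_wpM2r//.
  exact: fine_penalty_ge0.
by rewrite mulrC; exact: cauchy_schwarz.
Qed.

Hypothesis full : forall u, domain psi u.
Variables (T : {linear H -> H}) (g : H) (alpha : R) (halpha : (0 < alpha)%R).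
Local Notation J := (functional_fine psi T g alpha).

Lemma functional_fine_cvg (C : R) (x : nat -> H) u :
  (forall v, p v <= C * `|v|)%R -> continuous T ->
  x k @[k --> \oo] --> u -> J (x k) @[k --> \oo] --> J u.
Proof.
move=> pC cT xu; apply: cvgD.
  have cTx : (T (x k) - g)%R @[k --> \oo] --> (T u - g)%R.
    by apply: cvgB; [apply: (cvg_comp x T xu); exact: cT|exact: cvg_cst].
  by rewrite expr2; under eq_fun do rewrite expr2; apply: cvgM; exact: cvg_norm.
apply: cvgM; first exact: cvg_cst.
(* Subadditivity turns the linear bound into a Lipschitz estimate. *)
have pB v w : (p v - p w <= C * `|v - w|)%R.
  rewrite lerBlDl -[in leLHS](subrK w v) addrC.
  apply: le_trans (fine_penaltyD hpsi (full _) (full _)) _.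
  by rewrite lerD2l.
apply/(@cvgrPdist_le _ R^o) => e e0.
have K0 : (0 < `|C| + 1)%R by rewrite ltr_wpDl.
have /cvgrPdist_le/(_ _ (divr_gt0 e0 K0)) := xu.
apply: filterS => k; rewrite ler_pdivlMr// => hk.
have h : (C * `|u - x k| <= e)%R.
  apply: le_trans hk; rewrite mulrC ler_wpM2l// (le_trans (ler_norm C))//.
  by rewrite lerDl.
rewrite /= ler_norml lerNl opprB (le_trans (pB _ _) h) andbT.
by apply: le_trans (pB _ _) _; rewrite distrC.
Qed.

(** Test with [t *: h], bound the penalty by convexity between [u] and [u + h], divide by [t] and
    let [t] tend to 0: the terms in [|T h|^2] cancel and the one in [|h|^2] vanishes. *)
Lemma first_order_condition (V : set H) u : subspace_of V ->
  (forall h, V h -> J u <= J (u + h) + (`|h| ^+ 2 - `|T h| ^+ 2))%R ->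
  forall h, V h -> (alpha * p u <= ip (T u - g) (T h) + alpha * p (u + h))%R.
Proof.
move=> sV hV h Vh; set r := (T u - g)%R.
have key (t : R) : (0 < t)%R -> (t <= 1)%R ->
    (alpha * p u <= ip r (T h) + alpha * p (u + h) + t * `|h| ^+ 2)%R.
  move=> t0 t1; have := hV _ (subspaceZ sV t Vh); rewrite /functional_fine.
  have -> : (T (u + t *: h) - g = r + t *: T h)%R.
    by rewrite linearD linearZ/= addrAC.
  rewrite (sqr_normD hH r) ipZr (linearZ_LR T t h) !normrZ !exprMn (gtr0_norm t0) -/r.
  have -> : (u + t *: h = (1 - t) *: u + t *: (u + h))%R.
    by rewrite scalerBl scale1r scalerDr addrA subrK.
  have := fine_penaltyD hpsi (full ((1 - t) *: u)%R) (full (t *: (u + h))%R).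
  rewrite !fine_penaltyZ// (gtr0_norm t0) ger0_norm ?subr_ge0// => cvx.
  have /(ler_wpM2l (ltW halpha)) := cvx; move: (p (_ + _)%R) => q acvx.
  rewrite !mulrDr in acvx.
  have hh : (0 <= t ^+ 2 * `|h| ^+ 2)%R by rewrite mulr_ge0 ?sqr_ge0.
  move=> le; rewrite -(ler_pM2l t0).
  by lra.
apply/ler_addgt0Pr => e e0.
have K0 : (0 < `|h| ^+ 2 + 1)%R by rewrite ltr_wpDl ?sqr_ge0.
pose t := Num.min 1%R (e / (`|h| ^+ 2 + 1))%R.
have t0 : (0 < t)%R by rewrite lt_min ltr01 divr_gt0.
have t1 : (t <= 1)%R by rewrite ge_min lexx.
apply: le_trans (key t t0 t1) _; rewrite lerD2l.
have te : (t * (`|h| ^+ 2 + 1) <= e)%R.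
  by rewrite -ler_pdivlMr// ge_min lexx orbT.
by lra.
Qed.

(** Expanding the data term around [u] leaves the nonnegative square [|T (v - u)|^2], so the
    first-order inequality is also sufficient. *)
Lemma functional_fine_le u v :
  (alpha * p u <= ip (T u - g) (T (v - u)) + alpha * p v)%R -> (J u <= J v)%R.
Proof.
move=> le; rewrite /functional_fine.
have -> : (T v - g = (T u - g) + T (v - u))%R.
  by rewrite linearB/= [RHS]addrC addrA subrK.
rewrite (sqr_normD hH (T u - g)%R); have := sqr_ge0 (`|T (v - u)|)%R.
by lra.
Qed.

(** The two-sided limit, read at [t] and at [- t], controls forward and backward differences by the
    same slope. *)
Lemma differentiable_wrtP (V : set H) u : differentiable_wrt psi V u ->
  exists zeta : H -> R, forall h, V h -> forall e : R, (0 < e)%R ->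
  exists2 d : R, (0 < d)%R & forall t : R, (0 < t)%R -> (t < d)%R ->
    (p (u + t *: h) - p u < t * (zeta h + e) /\
     p u - p (u - t *: h) > t * (zeta h - e))%R.
Proof.
move=> [zeta _ dz]; exists zeta => h /dz dzh e e0.
have {}dzh : ((p (u + t *: h) - p u) / t)%R @[t --> (0%R : R)^'] --> zeta h.
  have /fine_cvgP[_] := dzh; apply: cvg_trans; apply: near_eq_cvg.
  near=> t; rewrite /= (domain_fine hpsi (full (u + t *: h)%R)).
  by rewrite (domain_fine hpsi (full u)).
have /cvgrPdist_lt/(_ _ e0) := dzh.
rewrite near_withinE => -[d /= d0 hd]; exists d => // t t0 td.
have := hd t; have := hd (- t)%R; rewrite /= !sub0r opprK normrN (gtr0_norm t0).
move=> /(_ td); rewrite oppr_eq0 gt_eqF// => /(_ isT) h1 /(_ td isT) h2.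
move: h1 h2; rewrite !ltr_distlC => /andP[h1 _] /andP[_ h2].
rewrite invrN mulrN scaleNr -mulNr opprB in h1.
rewrite ltr_pdivlMr// mulrC in h1; rewrite ltr_pdivrMr// mulrC in h2.
by [].
Unshelve. all: by end_near. Qed.

(* Convexity turns optimality along [h2] at the midpoint of [u + t (h1 + h2)]
   and [u - t h1] into a bound on [psi (u + h1 + h2)] whose error is the
   difference quotient of [psi] along [-h1]. *)
Lemma separate_optimality (V1 V2 : set H) u :
  subspace_of V1 -> subspace_of V2 ->
  (forall h, V1 h -> alpha * p u <= ip (T u - g) (T h) + alpha * p (u + h))%R ->
  (forall h, V2 h -> alpha * p u <= ip (T u - g) (T h) + alpha * p (u + h))%R ->
  differentiable_wrt psi V1 u ->
  forall h1 h2, V1 h1 -> V2 h2 ->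
  (alpha * p u <= ip (T u - g) (T (h1 + h2)) + alpha * p (u + (h1 + h2)))%R.
Proof.
move=> sV1 sV2 o1 o2 /differentiable_wrtP[zeta dz] h1 h2 Vh1 Vh2.
apply/ler_addgt0Pr => e e0.
(* Two errors of this size, each multiplied by [alpha], add up to [e]. *)
have e'0 : (0 < e / (2 * alpha))%R by rewrite divr_gt0// mulr_gt0.
have [d d0 hd] := dz h1 Vh1 _ e'0.
pose t := Num.min 1%R (d / 2)%R.
have t0 : (0 < t)%R by rewrite lt_min ltr01 divr_gt0.
have t1 : (t <= 1)%R by rewrite ge_min lexx.
have td : (t < d)%R.
  by apply: (@le_lt_trans _ _ (d / 2)%R); [rewrite ge_min lexx orbT|lra].
have [up dn] := hd t t0 td.
have k1 := o1 _ (subspaceZ sV1 t Vh1).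
have k2 := o2 _ (subspaceZ sV2 (t / 2) Vh2).
rewrite (linearZ_LR T) ipZr in k1; rewrite (linearZ_LR T) ipZr in k2.
rewrite (linearD T) ipDr.
have m : (p (u + (t / 2) *: h2) <=
    ((1 - t) * p u + t * p (u + (h1 + h2)) + p (u - t *: h1)) / 2)%R.
  have -> : (u + (t / 2) *: h2 =
      2^-1 *: (((1 - t) *: u + t *: (u + (h1 + h2))) + (u - t *: h1)))%R.
    have -> : ((1 - t) *: u + t *: (u + (h1 + h2)) + (u - t *: h1) =
        u + u + t *: h2)%R.
      rewrite scalerBl scale1r !scalerDr (addrA _ (t *: u)) subrK addrACA.
      by rewrite (addrC (t *: h1)) addrK.
    rewrite scalerDr scalerA -mulr2n -[(u *+ 2)%R]scaler_nat scalerA mulVf//.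
    by rewrite scale1r mulrC.
  rewrite fine_penaltyZ// gtr0_norm// mulrC ler_pM2r//.
  apply: le_trans (fine_penaltyD hpsi (full _) (full _)) _; rewrite lerD2r.
  apply: le_trans (fine_penaltyD hpsi (full _) (full _)) _.
  by rewrite !fine_penaltyZ// (gtr0_norm t0) ger0_norm// subr_ge0.
set a1 := ip _ (T h1) in k1 *; set a2 := ip _ (T h2) in k2 *.
have am := ler_wpM2l (ltW halpha) m.
have aup : (alpha * (p (u + t *: h1) - p u) < t * (alpha * zeta h1) + t * (e / 2))%R.
  rewrite [ltRHS](_ : _ = alpha * (t * (zeta h1 + e / (2 * alpha))))%R.
    by rewrite ltr_pM2l.
  by field; rewrite gt_eqF.
have adn : (t * (alpha * zeta h1) - t * (e / 2) < alpha * (p u - p (u - t *: h1)))%R.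
  rewrite [ltLHS](_ : _ = alpha * (t * (zeta h1 - e / (2 * alpha))))%R.
    by rewrite ltr_pM2l.
  by field; rewrite gt_eqF.
(* [k1] with [aup] bounds [- a1] above by the slope [alpha * zeta h1]; [k2] with [am] and [adn]
   bounds that slope above. The slope cancels, each bound costing [e / 2]. *)
by rewrite -(ler_pM2l t0); lra.
Qed.

End FiniteDimensionalOptimality.

(** * Passing inner minimality to the limit *)

Section LimitOptimality.
Context {R : realType} {H : completeNormedModType R}.

Lemma bounded_operator_continuous (T : {linear H -> H}) :
  bounded_operator T -> continuous T.
Proof.
move=> [B TB]; apply/bounded_linear_continuous/linear_boundedP.
near=> M => x; apply: le_trans (TB x) _; rewrite ler_wpM2r//.
Unshelve. all: by end_near. Qed.

Lemma sqr_dominated_cvg0 (x : nat -> H) (delta : nat -> R) (kappa K : R) :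
  (0 < kappa)%R -> (0 <= K)%R ->
  (forall n, kappa * `|x n| ^+ 2 <= K * delta n)%R ->
  delta @ \oo --> (0%R : R) -> x @ \oo --> (0%R : H).
Proof.
move=> k0 K0 xd d0; apply/cvgrPdist_lt => e e0.
have K1 : (0 < K + 1)%R by rewrite ltr_wpDl.
have e'0 : (0 < kappa * e ^+ 2 / (K + 1))%R by rewrite divr_gt0 ?mulr_gt0 ?exprn_gt0.
have /cvgrPdist_lt/(_ _ e'0) := d0.
apply: filterS => n; rewrite !sub0r !normrN => dn.
rewrite -ltr_sqr ?nnegrE ?(ltW e0)// -(ltr_pM2l k0).
apply: le_lt_trans (xd n) _.
apply: (@le_lt_trans _ _ ((K + 1) * `|delta n|)%R).
  by have := ler_norm (delta n); have := normr_ge0 (delta n); nra.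
by rewrite mulrC -ltr_pdivlMr.
Qed.

Lemma subsequence_cvg (f : nat -> nat) : subsequence f -> f @ \oo --> \oo.
Proof.
move=> fi A [N _ NA]; exists N => // n /= Nn; apply: NA => /=.
apply: leq_trans Nn _; elim: n => // n IH.
by apply: leq_ltn_trans IH _; exact: fi.
Qed.

Variables (ip : {dot H for idfun}) (hH : hilbert ip).
Variables (psi : H -> \bar R) (hpsi : penalty psi).
Hypothesis full : forall u, domain psi u.
Variables (T : {linear H -> H}) (g : H) (alpha : R) (halpha : (0 < alpha)%R).
Variables (kappa : R) (kappa0 : (0 < kappa)%R).
Hypothesis hkappa : forall u : H, (kappa * `|u| ^+ 2 <= `|u| ^+ 2 - `|T u| ^+ 2)%R.
Local Notation J := (functional_fine psi T g alpha).

(** Minimality of [y k] is tested against [a k + h], where the surrogate term does not depend on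
    [k]; at [y k] that term is nonnegative and is dropped. Continuity of the functional gives the
    limit. *)
Lemma limit_optimality (C : R) (V : set H) (a b y : nat -> H) uoo :
  (forall v, fine (psi v) <= C * `|v|)%R -> continuous T ->
  subspace_of V -> (forall k, V (a k)) ->
  (forall k, minimizer_on V
     (fun v => surrogate psi T g alpha (v + b k)%R v (a k)) (y k)) ->
  (a k + b k)%R @[k --> \oo] --> uoo ->
  (y k - a k)%R @[k --> \oo] --> (0%R : H) ->
  forall h, V h -> (J uoo <= J (uoo + h) + (`|h| ^+ 2 - `|T h| ^+ 2))%R.
Proof.
move=> pC cT sV Va ymin abu ya h Vh.
have cJ := functional_fine_cvg (g := g) (alpha := alpha) hpsi full pC cT.
have yu : (y k + b k)%R @[k --> \oo] --> uoo.
  rewrite (_ : (fun k => _) = fun k => ((y k - a k) + (a k + b k))%R).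
    by rewrite -[uoo]add0r; exact: cvgD.
  by apply/funext => k; rewrite addrA subrK.
have ahu : (a k + b k + h)%R @[k --> \oo] --> (uoo + h)%R.
  by apply: cvgD => //; exact: cvg_cst.
have l1 := cJ _ _ yu.
have l2 : (J (a k + b k + h) + (`|h| ^+ 2 - `|T h| ^+ 2))%R @[k --> \oo] -->
    (J (uoo + h) + (`|h| ^+ 2 - `|T h| ^+ 2))%R.
  by apply: cvgD; [exact: cJ ahu|exact: cvg_cst].
apply: (ler_cvg_to l1 l2); near=> k.
have [_ /(_ _ (subspaceD sV (Va k) Vh))] := ymin k.
rewrite /surrogate => /(le_functional_fine hpsi halpha (full _))[_].
rewrite [(a k + h - a k)%R]addrAC subrr add0r [(a k + h + b k)%R]addrAC.
apply: le_trans; rewrite lerDl; apply: le_trans (hkappa _).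
by rewrite mulr_ge0 ?sqr_ge0// ltW.
Unshelve. all: by end_near. Qed.

End LimitOptimality.

(** * Descent over one outer iteration *)

Section ParallelDescent.
Context {R : realType} {H : completeNormedModType R}.
Variables (ip : {dot H for idfun}) (hH : hilbert ip).
Variables (psi : H -> \bar R) (hpsi : penalty psi).
Variables (V1 V2 : set H) (hV : orthogonal_splitting ip V1 V2).
Variables (T : {linear H -> H}) (g : H) (alpha : R) (halpha : (0 < alpha)%R).
Variables (kappa : R) (kappa0 : (0 < kappa)%R).
Hypothesis hkappa : forall u : H, (kappa * `|u| ^+ 2 <= `|u| ^+ 2 - `|T u| ^+ 2)%R.
Variables (L M : nat) (u : nat -> H) (u1 u2 : nat -> nat -> H).
Hypothesis hu : parallel_algorithm psi T g alpha ip V1 V2 L M u u1 u2.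
Local Notation J := (functional_fine psi T g alpha).
Local Notation pi1 := (orthproj ip V1).
Local Notation pi2 := (orthproj ip V2).

(** [u n.+1] is the midpoint of [x] and [y], neither of which has a larger value than [u n]. By
    convexity each of their decreases is at most [2 * delta], whence the factor 2. *)
Lemma outer_descent n : domain psi (u n) ->
  let delta := (J (u n) - J (u n.+1))%R in
  [/\ domain psi (u n.+1),
      forall l, (l <= L)%N ->
        (kappa * `|u1 n.+1 l - pi1 (u n)| ^+ 2 <= (2 * 4 ^+ l) * delta)%R,
      forall m, (m <= M)%N ->
        (kappa * `|u2 n.+1 m - pi2 (u n)| ^+ 2 <= (2 * 4 ^+ m) * delta)%R &
      (kappa * `|u n.+1 - u n| ^+ 2 <= (4 ^+ L + 4 ^+ M) * delta)%R].
Proof.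
move=> dun /=; have [V1a V2b ab] := orthproj_split hH hV (u n).
have [||_ dx hx] := inner_descent (w := u1 n.+1) (b := pi2 (u n)) hH hpsi halpha
    kappa0 hkappa _ _ (@parallel_step1 _ _ _ _ _ _ _ _ _ _ _ _ _ _ hu n).
- by rewrite (parallel_init1 hu).
- by rewrite (parallel_init1 hu) ab.
have ymin m : (m < M)%N -> minimizer_on V2
    (fun v => surrogate psi T g alpha (v + pi1 (u n))%R v (u2 n.+1 m)) (u2 n.+1 m.+1).
  move=> mM; have [V2y le] := parallel_step2 hu n mM; split=> // v /le.
  by rewrite ![(pi1 (u n) + _)%R]addrC.
have [||_ dy hy] := inner_descent (w := u2 n.+1) (b := pi1 (u n)) hH hpsi halpha
    kappa0 hkappa _ _ ymin.
- by rewrite (parallel_init2 hu).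
- by rewrite (parallel_init2 hu) addrC ab.
rewrite (parallel_init1 hu) ab in hx.
rewrite (parallel_init2 hu) [(pi2 (u n) + _)%R]addrC ab in hy.
set x := (u1 n.+1 L + _)%R in dx hx; set y := (u2 n.+1 M + _)%R in dy hy.
have uE : u n.+1 = (2^-1 *: (x + y))%R.
  rewrite (parallel_average hu) -{1}ab /x /y; congr (_ *: _)%R.
  by rewrite [(pi1 (u n) + _)%R]addrC addrACA.
have [du1 Ju1] := functional_fine_mid hH hpsi T g halpha dx dy.
rewrite -uE in du1 Ju1.
have Jx := hx 0%N (leq0n _); have Jy := hy 0%N (leq0n _).
rewrite (parallel_init1 hu) subrr normr0 expr0n mulr0 mul1r in Jx.
rewrite (parallel_init2 hu) subrr normr0 expr0n mulr0 mul1r in Jy.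
have hx' l : (l <= L)%N ->
    (kappa * `|u1 n.+1 l - pi1 (u n)| ^+ 2 <= 2 * 4 ^+ l * (J (u n) - J (u n.+1)))%R.
  move=> /hx /le_trans; apply; rewrite [(2 * _)%R]mulrC -mulrA ler_pM2l ?exprn_gt0//.
  by lra.
have hy' m : (m <= M)%N ->
    (kappa * `|u2 n.+1 m - pi2 (u n)| ^+ 2 <= 2 * 4 ^+ m * (J (u n) - J (u n.+1)))%R.
  move=> /hy /le_trans; apply; rewrite [(2 * _)%R]mulrC -mulrA ler_pM2l ?exprn_gt0//.
  by lra.
split=> //; have := hx' L (leqnn L); have := hy' M (leqnn M).
set X := (u1 n.+1 L - _)%R; set Y := (u2 n.+1 M - _)%R => HY HX.
have -> : (u n.+1 - u n = 2^-1 *: (X + Y))%R.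
  rewrite uE /X /Y -[in LHS]ab.
  have -> : (x = X + (pi1 (u n) + pi2 (u n)))%R by rewrite addrA subrK.
  have -> : (y = Y + (pi1 (u n) + pi2 (u n)))%R by rewrite addrCA subrK addrC.
  rewrite addrACA -mulr2n -[((pi1 (u n) + pi2 (u n)) *+ 2)%R]scaler_nat.
  by rewrite [in LHS]scalerDr scalerA mulVf// scale1r addrK.
(* Dropping [|X - Y|^2] gives [4 |(X + Y) / 2|^2 <= 2 |X|^2 + 2 |Y|^2], so the factors 2 cancel
   against the 4. *)
have := parallelogram hH X Y; have := sqr_ge0 (`|X - Y|)%R.
move: (`|X - Y| ^+ 2)%R => s s0 par.
have : (kappa * (4 * `|2^-1 *: (X + Y)| ^+ 2) <=
    kappa * (2 * `|X| ^+ 2 + 2 * `|Y| ^+ 2))%R.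
  by apply: ler_wpM2l; [exact: ltW|lra].
by lra.
Qed.

End ParallelDescent.

(** * Global minimality under condition (a) or (b) *)

Section Cases.
Context {R : realType} {H : completeNormedModType R}.
Variables (ip : {dot H for idfun}) (hH : hilbert ip).
Variables (psi : H -> \bar R) (hpsi : penalty psi).
Hypothesis full : forall u : H, domain psi u.
Variables (V1 V2 : set H) (hV : orthogonal_splitting ip V1 V2).
Variables (T : {linear H -> H}) (g : H) (alpha : R) (halpha : (0 < alpha)%R).
Local Notation J := (functional_fine psi T g alpha).
Local Notation p u := (fine (psi u)).
Variable u : H.
Hypothesis o1 : forall h, V1 h ->
  (alpha * p u <= ip (T u - g) (T h) + alpha * p (u + h))%R.
Hypothesis o2 : forall h, V2 h ->
  (alpha * p u <= ip (T u - g) (T h) + alpha * p (u + h))%R.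

(** Add the two partial conditions for the components of [v - u]: the shifted points are [u1 + v2]
    and [u2 + v1], exactly those that the inequality compares when [eta1] and [eta2] are the
    components of [v]. *)
Lemma minimizer_of_splitting_inequality :
  (forall eta1 eta2, V1 eta1 -> V2 eta2 ->
     psi (orthproj ip V1 u + eta2)%R + psi (orthproj ip V2 u + eta1)%R
       - psi (orthproj ip V1 u + orthproj ip V2 u)%R <= psi (eta1 + eta2)%R) ->
  forall v, (J u <= J v)%R.
Proof.
move=> ineq v; apply: (functional_fine_le hH).
have [[sV1 _] [sV2 _] _ _] := hV.
have [V1u V2u eu] := orthproj_split hH hV u.
have [V1v V2v ev] := orthproj_split hH hV v.
have {ineq} : (p (orthproj ip V1 u + orthproj ip V2 v) +
    p (orthproj ip V2 u + orthproj ip V1 v) - p u <= p v)%R.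
  rewrite -lee_fin EFinB EFinD -!(domain_fine hpsi (full _)).
  by have := ineq _ _ V1v V2v; rewrite eu ev.
move=> /(ler_wpM2l (ltW halpha)).
have := o1 (subspaceB sV1 V1v V1u); have := o2 (subspaceB sV2 V2v V2u).
have -> : (u + (orthproj ip V2 v - orthproj ip V2 u) =
    orthproj ip V1 u + orthproj ip V2 v)%R.
  rewrite addrCA addrC; congr +%R; apply/eqP.
  by rewrite subr_eq eu.
have -> : (u + (orthproj ip V1 v - orthproj ip V1 u) =
    orthproj ip V2 u + orthproj ip V1 v)%R.
  rewrite addrCA addrC; congr +%R; apply/eqP.
  by rewrite subr_eq addrC eu.
have -> : (v - u = (orthproj ip V1 v - orthproj ip V1 u) +
    (orthproj ip V2 v - orthproj ip V2 u))%R.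
  by rewrite addrACA -opprD eu ev.
by rewrite (linearD T) ipDr; lra.
Qed.

Lemma minimizer_of_differentiable :
  differentiable_wrt psi V1 u \/ differentiable_wrt psi V2 u ->
  forall v, (J u <= J v)%R.
Proof.
have [[sV1 _] [sV2 _] _ _] := hV.
move=> diff v; apply: (functional_fine_le hH).
have [V1w V2w ew] := orthproj_split hH hV (v - u)%R.
suff : (alpha * p u <= ip (T u - g) (T (orthproj ip V1 (v - u) + orthproj ip V2 (v - u)))
    + alpha * p (u + (orthproj ip V1 (v - u) + orthproj ip V2 (v - u))))%R.
  by rewrite ew subrKC.
case: diff => diff.
  exact: (separate_optimality hpsi full halpha sV1 sV2 o1 o2 diff).
rewrite [(orthproj ip V1 _ + _)%R]addrC.
exact: (separate_optimality hpsi full halpha sV2 sV1 o2 o1 diff).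
Qed.

End Cases.

(** * Monotonicity, vanishing increments, compactness and optimality of the iterates *)

Theorem theorem6p1 (R : realType) (H : completeNormedModType R)
  (ip : {dot H for idfun}) (hH : hilbert ip) (hsep : separable H)
  (psi : H -> \bar R) (hpsi : penalty psi)
  (X : topologicalType) (j : X -> H) (htau : penalty_topology psi j)
  (V1 V2 : set H) (hV : orthogonal_splitting ip V1 V2)
  (hpi1 : compatible_projection psi ip V1)
  (hpi2 : compatible_projection psi ip V2)
  (T : {linear H -> H}) (hTb : bounded_operator T)
  (hT : (operator_norm T < 1)%R)
  (g : H) (alpha : R) (halpha : (0 < alpha)%R)
  (hcoer : coercive psi T g alpha)
  (L M : nat) (hL : (1 <= L)%N) (hM : (1 <= M)%N)
  (u : nat -> H) (u1 u2 : nat -> nat -> H)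
  (hu0 : domain psi (u 0%N))
  (hu : parallel_algorithm psi T g alpha ip V1 V2 L M u u1 u2) :
  let J := functional psi T g alpha in
  let pi1 := orthproj ip V1 in
  let pi2 := orthproj ip V2 in
  (forall n, domain psi (u n)) /\
  [/\ (* (i) *)
      forall n, u n <> u n.+1 -> J (u n.+1) < J (u n),
      (* (ii) *)
      (`|u n.+1 - u n|%R : R) @[n --> \oo] --> (0%R : R),
      (* (iii) *)
      exists f : nat -> nat, [/\ subsequence f,
        exists l : H, weakly_cvg (u \o f) l &
        exists l : X, penalty_topology_cvg j (u \o f) l] &
      (* (iv) *)
      finite_dimensional H ->
      forall (f : nat -> nat) (uoo : H), subsequence f ->
      u (f k) @[k --> \oo] --> uoo ->
      (forall eta1 eta2, V1 eta1 -> V2 eta2 ->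
         psi (pi1 uoo + eta2)%R + psi (pi2 uoo + eta1)%R
           - psi (pi1 uoo + pi2 uoo)%R <= psi (eta1 + eta2)%R)
      \/ (differentiable_wrt psi V1 uoo \/ differentiable_wrt psi V2 uoo) ->
      forall v, J uoo <= J v].
Proof.
move=> J pi1 pi2.
have [kappa k0 hk] := contraction_gap hTb hT.
pose Jr := functional_fine psi T g alpha.
have dom n : domain psi (u n).
  elim: n => // n dn.
  by have [] := outer_descent hH hpsi hV halpha k0 hk hu dn.
have desc n := outer_descent hH hpsi hV halpha k0 hk hu (dom n).
have K0 : (0 < 4 ^+ L + 4 ^+ M :> R)%R by rewrite addr_gt0 ?exprn_gt0.
have Jdec n : (Jr (u n.+1) <= Jr (u n))%R.
  have [_ _ _ h] := desc n; rewrite -subr_ge0 -(pmulr_rge0 _ K0).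
  by apply: le_trans h; rewrite mulr_ge0 ?sqr_ge0// ltW.
have Jle n : (Jr (u n) <= Jr (u 0%N))%R.
  by elim: n => // n; exact: le_trans (Jdec n).
(* A nonincreasing sequence bounded below by 0 converges, so its successive differences vanish. *)
have dlim : (Jr (u n) - Jr (u n.+1))%R @[n --> \oo] --> (0%R : R).
  have cJ : cvgn (Jr \o u).
    apply: nonincreasing_is_cvgn; first exact/nonincreasing_seqP.
    by exists 0%R => _ [n _ <-]; exact: functional_fine_ge0.
  rewrite -(subrr (limn (Jr \o u))); apply: cvgB => //.
  by have := cJ; rewrite -(cvg_shiftS (Jr \o u)).
split; first by [].
split.
- move=> n une; rewrite /J !functional_fineE// lte_fin -subr_gt0 -(pmulr_rgt0 _ K0).
  have [_ _ _ h] := desc n; apply: lt_le_trans h.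
  rewrite mulr_gt0// exprn_gt0// normr_gt0 subr_eq0.
  by apply/eqP => E; apply: une.
- apply/norm_cvg0P.
  apply: (sqr_dominated_cvg0 k0 (ltW K0) _ dlim) => n.
  by have [_ _ _ h] := desc n.
- have [B uB] : exists B : R, forall n, (`|u n| <= B)%R.
    have [B [_ hB]] := hcoer (Jr (u 0%N)).
    exists (B + 1)%R => n; apply: (hB (B + 1)%R); first by rewrite ltrDl.
    by rewrite /= functional_fineE// lee_fin.
  have /choice[x xu] n : exists x, j x = u n.
    have [y _ yu] : range j (u n).
      by rewrite (penalty_topology_range htau); exact: dom.
    by exists y.
  have [|f [fs [l xl]]] := penalty_topology_compact htau (w := x).
    (* Coercivity bounds the norm by [B]; the penalty term alone is at most [Jr (u 0)]. *)
    exists (B + Jr (u 0%N) / (2 * alpha))%R => n.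
    rewrite xu /domain_norm (domain_fine hpsi (dom n)) -EFinD lee_fin lerD//.
    rewrite ler_pdivlMr ?mulr_gt0// mulrC; apply: le_trans (Jle n).
    by rewrite lerDr sqr_ge0.
  (* The weak limit is extracted from the subsequence already convergent in the penalty topology, so
     that one subsequence serves both. *)
  have [|f' [fs' [l' ul']]] := @bounded_weakly_cvg_subseq _ _ ip hH (u \o f) B hsep.
    by move=> n; exact: uB.
  exists (f \o f'); split.
  + by move=> m n mn; apply: fs; exact: fs'.
  + by exists l'.
  + exists l; exists (x \o f \o f') => [k|]; first exact: xu.
    exact: (cvg_comp f' (x \o f) (subsequence_cvg fs') xl).
- move=> fd f uoo fs fu cases v.
  have [full [C pC]] := penalty_finite_dimensional hH hpsi fd.
  have cT := bounded_operator_continuous hTb.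
  have [[sV1 _] [sV2 _] _ _] := hV.
  have split n := orthproj_split hH hV (u n).
  have dlimf := cvg_comp f _ (subsequence_cvg fs) dlim.
  have fu' : (orthproj ip V1 (u (f k)) + orthproj ip V2 (u (f k)))%R @[k --> \oo] --> uoo.
    by rewrite (_ : (fun k => _) = u \o f)//; apply/funext => k; have [] := split (f k).
  have o1 : forall h, V1 h ->
      (alpha * fine (psi uoo) <= ip (T uoo - g) (T h) + alpha * fine (psi (uoo + h)))%R.
    apply: (first_order_condition hH hpsi full halpha sV1).
    (* The first inner step, available since [L >= 1], starts at the component of [u (f k)] itself,
       and its length tends to 0 by the outer descent bound. *)
    apply: (limit_optimality (a := fun k => orthproj ip V1 (u (f k)))
      (b := fun k => orthproj ip V2 (u (f k))) (y := fun k => u1 (f k).+1 1%N)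
      hpsi full halpha k0 hk pC cT sV1) => //.
    + by move=> k; have [] := split (f k).
    + by move=> k; have := parallel_step1 hu (f k) hL; rewrite (parallel_init1 hu).
    + apply: (sqr_dominated_cvg0 k0 (K := (2 * 4 ^+ 1)%R) _ _ dlimf) => // k.
      by have [_ h _ _] := desc (f k); exact: h.
  have o2 : forall h, V2 h ->
      (alpha * fine (psi uoo) <= ip (T uoo - g) (T h) + alpha * fine (psi (uoo + h)))%R.
    apply: (first_order_condition hH hpsi full halpha sV2).
    apply: (limit_optimality (a := fun k => orthproj ip V2 (u (f k)))
      (b := fun k => orthproj ip V1 (u (f k))) (y := fun k => u2 (f k).+1 1%N)
      hpsi full halpha k0 hk pC cT sV2) => //.
    + by move=> k; have [] := split (f k).
    + move=> k; have := parallel_step2 hu (f k) hM; rewrite (parallel_init2 hu).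
      move=> [V2y ymin]; split=> // w /ymin.
      by rewrite ![(orthproj ip V1 _ + _)%R]addrC.
    + by under eq_fun do rewrite addrC.
    + apply: (sqr_dominated_cvg0 k0 (K := (2 * 4 ^+ 1)%R) _ _ dlimf) => // k.
      by have [_ _ h _] := desc (f k); exact: h.
  rewrite /J !functional_fineE// lee_fin.
  by case: cases => [/(minimizer_of_splitting_inequality hH hpsi full hV halpha o1 o2)|
    /(minimizer_of_differentiable hH hpsi full hV halpha o1 o2)].
Qed.
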